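(* Assume the Continuum Hypothesis. If $X$ is a $T_1$ topological space with a zero-set diagonal and caliber $\omega_1$, then $X$ is submetrizable.
   Context: All spaces are topological $T_1$-spaces. For a space $X$ let $\Delta_X=\{(x,x):x\in X\}\subset X\times X$. $X$ has a zero-set diagonal if there is a continuous function $f\colon X\times X\to\mathbb{R}$ such that $\Delta_X=f^{-1}(0)$. $\omega_1$ is a caliber of $X$ (X has caliber $\omega_1$) if every uncountable family $\mathcal{U}$ of non-empty open subsets of $X$ has an uncountable subfamily $\mathcal{U}'$ such that $\bigcap\mathcal{U}'\neq\emptyset$. A space $(X,\tau)$ is submetrizable if there is a topology $\tau'\subset\tau$ on $X$ such that $(X,\tau')$ is metrizable. *)

(* Defs.v *)
From HB Require Import structures.
From mathcomp Require Import all_boot all_order all_algebra.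
From mathcomp Require Import all_classical all_reals.
From mathcomp Require Import topology.

Set Implicit Arguments.
Unset Strict Implicit.
Unset Printing Implicit Defensive.

Import numFieldTopology.Exports.
Local Open Scope classical_set_scope.
Local Open Scope card_scope.
Local Open Scope ring_scope.

(* No cardinality lies strictly between those of [nat] and of the reals
   ([countable] includes the finite sets). *)
Definition continuum_hypothesis (R : realType) : Prop :=
  forall A : set R, countable A \/ A #= [set: R].

Definition zero_set_diagonal (R : realType) (X : topologicalType) : Prop :=
  exists f : X * X -> R, continuous f /\ diagonal = f @^-1` [set 0].

Definition caliber_omega1 (X : topologicalType) : Prop :=
  forall U : set (set X),
    ~ countable U ->
    (forall A, U A -> open A /\ A !=set0) ->
    exists V : set (set X),
      [/\ V `<=` U, ~ countable V & \bigcap_(A in V) A !=set0].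

(* [m] ranges over the metric structures on the carrier of [X]; its
   distance must induce the given topology. *)
Definition metrizable (R : realType) (X : topologicalType) : Prop :=
  exists m : Metric R X,
    @open (Metric.Pack m) = @open X.

(* [tau'] ranges over the topologies on the carrier of [X]. *)
Definition submetrizable (R : realType) (X : topologicalType) : Prop :=
  exists tau' : Topological X,
    @open (Topological.Pack tau') `<=` @open X /\
    metrizable R (Topological.Pack tau').

(* Main.v *)
Require Import Defs.
From HB Require Import structures.
From mathcomp Require Import all_boot all_order all_algebra.
From mathcomp Require Import all_classical all_reals.
From mathcomp Require Import topology normedtype.
From mathcomp Require wochoice.
From mathcomp Require Import lra.

(** The key point is that a space [X] with caliber omega_1 and a zero-set
    diagonal is separable under CH; the rest is classical.

    Cardinality.  Caliber omega_1 passes to [X * X] in the weak form that both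
    [X] and [X * X] satisfy the countable chain condition, so any union of open
    sets contains a dense countable subunion ([ccc_dense_subfamily]).  Let [f]
    witness the zero-set diagonal and fix [e > 0].  Choose countably many open
    rectangles [A i `*` B i], contained in [|f| > e] and with dense union there,
    and put [avoid A I = ~` closure (\bigcup_(i in I) A i)] for a set [I] of
    indices.  If an open rectangle [P `*` Q] around [(z, p)] lies in
    [|f| < e], it misses every [A i `*` B i]; let [I] be the set of the [i] such
    that [P] misses [A i], so that [Q] misses [B i] for all other [i].  Then
    [avoid A I] contains [P], and it contains no [u] with [|f (u, p)| > e]:
    otherwise some [A i `*` B i] would meet [avoid A I `*` Q].  By the countable
    chain condition, countably many of these sets [avoid A I] have a union which
    is dense in the slice [|f (_, p)| < e] and stays inside [|f (_, p)| <= e]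
    ([coded_slices]).  Letting [e] run through the numbers [1 / n.+1], the point
    [p] is recovered from a double sequence of sets of naturals
    ([coded_points]), and [X] has at most the cardinality of the continuum.

    Separability.  CH now gives a total relation on [X] all of whose initial
    segments are countable ([countable_segments]).  If no countable set were
    dense, the complements of the closures of the initial segments would be
    nonempty open sets; by caliber omega_1 some point would lie in uncountably
    many of them, although that point itself belongs to all but countably many
    initial segments ([caliber_separable]).

    Submetrizability.  If [D] is countable and dense, the functions [f (_, z)]
    for [z] in [D] separate points: if they agree at [x] and [y], then
    [f (y, x) = f (x, x) = 0] by density.  A separating sequence of continuous
    functions defines a distance whose balls are open in [X]
    ([submetrizable_separating_sequence]). *)

Import Order.TTheory GRing.Theory Num.Theory.
Import numFieldTopology.Exports numFieldNormedType.Exports.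
Local Open Scope classical_set_scope.
Local Open Scope card_scope.
Local Open Scope ring_scope.

(** * Caliber omega_1 and the countable chain condition *)

(** The countable chain condition: every family of pairwise disjoint nonempty
    open sets is countable. *)
Definition ccc (Z : topologicalType) : Prop :=
  forall F : set (set Z),
    (forall A, F A -> open A /\ A !=set0) -> trivIset F id -> countable F.

Lemma uncountable_fiber {I J : Type} {T : set I} {h : I -> J} :
  ~ countable T -> countable (h @` T) ->
  exists j, ~ countable (T `&` h @^-1` [set j]).
Proof.
move=> Tunc hT; apply: contrapT => /forallNP allc; apply: Tunc.
have -> : T = \bigcup_(j in h @` T) (T `&` h @^-1` [set j]).
  apply/seteqP; split => [i Ti|i [j _ []]//].
  by exists (h i) => //; exists i.
by apply: bigcup_countable => // j _; apply: contrapT; exact: allc.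
Qed.

(** Caliber omega_1 for indexed families, in which an open set may be repeated
    uncountably often. *)
Lemma caliber_indexed {X : topologicalType} (hcal : caliber_omega1 X)
    {I : Type} {T : set I} {A : I -> set X} :
  ~ countable T -> (forall t, T t -> open (A t) /\ A t !=set0) ->
  exists T' : set I,
    [/\ T' `<=` T, ~ countable T' & exists a, forall t, T' t -> A t a].
Proof.
move=> Tunc AT; have [cA|ncA] := pselect (countable (A @` T)).
  have [B Bunc] := uncountable_fiber Tunc cA.
  exists (T `&` A @^-1` [set B]); split => //.
  have [t [Tt /= AtB]] : (T `&` A @^-1` [set B]) !=set0.
    by apply/set0P/negP => /eqP TB0; apply: Bunc; rewrite TB0.
  have [_ [a Ata]] := AT _ Tt; exists a => s [_ /= ->].
  by rewrite -AtB.
have [|V [VA Vunc [a aV]]] := hcal (A @` T) ncA.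
  by move=> _ [t Tt <-]; exact: AT.
exists (T `&` A @^-1` V); split; first by move=> i [].
- move=> cTV; apply: Vunc.
  apply: (@sub_countable _ _ V (A @` (T `&` A @^-1` V))).
    apply: subset_card_le => B VB; have [t Tt tB] := VA _ VB.
    by exists t => //; split => //=; rewrite tB.
  exact: sub_countable (card_image_le _ _) cTV.
- by exists a => t [_ /= VAt]; exact: aV.
Qed.

Lemma caliber_ccc (X : topologicalType) : caliber_omega1 X -> ccc X.
Proof.
move=> hcal F oF tF; apply: contrapT => Func.
have [G [GF Gunc [a aG]]] := caliber_indexed hcal Func oF.
apply: Gunc; have [->|/set0P[A GA]] := eqVneq G set0; first exact: countable0.
apply: (sub_countable (B := [set A])); last exact: countable1.
apply: subset_card_le => B GB; apply/esym; apply: (tF A B); try exact: GF.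
by exists a; split; exact: aG.
Qed.

(** Each member of a disjoint family in [X * X] is shrunk to a rectangle;
    caliber omega_1 is applied to the first sides, then to the second sides of
    those that remain. *)
Lemma caliber_ccc_prod (X : topologicalType) :
  caliber_omega1 X -> ccc (X * X)%type.
Proof.
move=> hcal F oF tF; apply: contrapT => Func.
have rect W : exists PQ : set X * set X, F W ->
    [/\ open PQ.1 /\ PQ.1 !=set0, open PQ.2 /\ PQ.2 !=set0
      & PQ.1 `*` PQ.2 `<=` W].
  have [FW|nFW] := pselect (F W); last by exists (set0, set0).
  have [oW [[x y] Wxy]] := oF _ FW.
  have [[/= P Q] [Px Qy] PQW] : nbhs (x, y) W by exact: open_nbhs_nbhs.
  exists (interior P, interior Q) => _; split => /=.
  - by split; [exact: open_interior|exists x].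
  - by split; [exact: open_interior|exists y].
  - by apply: subset_trans PQW; apply: setSX; exact: interior_subset.
have [PQ PQF] := choice rect.
have [F1 [F1F F1unc [a aF1]]] := caliber_indexed hcal (A := fun W => (PQ W).1) Func
  (fun W FW => let: And3 p _ _ := PQF W FW in p).
have [F2 [F2F1 F2unc [b bF2]]] := caliber_indexed hcal (A := fun W => (PQ W).2) F1unc
  (fun W FW => let: And3 _ p _ := PQF W (F1F _ FW) in p).
apply: F2unc; have [->|/set0P[A F2A]] := eqVneq F2 set0; first exact: countable0.
apply: (sub_countable (B := [set A])); last exact: countable1.
have inF W : F2 W -> W (a, b).
  move=> F2W; have F1W := F2F1 _ F2W; have [_ _] := PQF _ (F1F _ F1W).
  by apply; split => /=; [exact: aF1|exact: bF2].
apply: subset_card_le => B F2B; apply/esym.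
apply: (tF A B); [by apply/F1F/F2F1|by apply/F1F/F2F1|].
by exists (a, b); split; exact: inF.
Qed.

(** A maximal disjoint family of nonempty open sets, each contained in some
    [U t], is countable, and choosing one such [t] for each member gives [g]. *)
Lemma ccc_dense_subfamily {Z : topologicalType} (hZ : ccc Z) {I : Type}
    {T : set I} (U : I -> set Z) :
  T !=set0 -> (forall t, T t -> open (U t)) ->
  exists g : nat -> I, (forall k, T (g k)) /\
    \bigcup_(t in T) U t `<=` closure (\bigcup_k U (g k)).
Proof.
move=> [t0 Tt0] oU.
pose D := [set W : set Z | (open W /\ W !=set0) /\ exists2 t, T t & W `<=` U t].
have [E [ED tE maxE]] := @ex_maximal_disjoint_subcollection _ _ (@id (set Z)) D.
have /countable_injP[h hinj] : countable E by apply: hZ => // A /ED[].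
have gP k : exists t, T t /\ forall W, E W -> h W = k -> W `<=` U t.
  have [[W [EW hW]]|nW] := pselect (exists W, E W /\ h W = k); last first.
    by exists t0; split => // W EW hW; case: nW; exists W.
  have [_ [t Tt WUt]] := ED _ EW; exists t; split => // V EV hV.
  by rewrite (hinj V W) ?inE ?hV ?hW.
have [g gT] := choice gP; exists g; split => [k|]; first by have [] := gT k.
move=> z [t Tt Utz] B; rewrite nbhsE => -[B' [oB' B'z] B'B].
apply: contrapT => dis.
have BU : D (B' `&` U t).
  split; last by exists t => // ? [].
  by split; [apply: openI => //; exact: oU|exists z].
have dE W : E W -> ~ (W `&` (B' `&` U t) !=set0).
  move=> EW [y [Wy [B'y Uty]]]; apply: dis; exists y; split; last exact: B'B.
  by exists (h W) => //; have [_] := gT (h W); apply; last exact: Wy.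
have nE : ~ E (B' `&` U t) by move/dE; apply; exists z.
apply: (maxE (E `|` [set B' `&` U t])).
- by split => [W|/(_ (B' `&` U t))]; [left|apply: contra_not nE; apply; right].
- by move=> W [/ED|->].
- move=> V W [EV|->] [EW|->] //=.
  + exact: tE.
  + by move/(dE _ EV).
  + by rewrite setIC => /(dE _ EW).
Qed.

(** * Coding the points by sets of natural numbers *)

Lemma open_disjoint_closure {Z : topologicalType} (U S : set Z) :
  open U -> U `&` S `<=` set0 -> U `<=` ~` closure S.
Proof.
move=> oU US z Uz /(_ U); case; first exact: open_nbhs_nbhs.
by move=> y [Sy Uy]; exact: (US y).
Qed.

Lemma openX {X Y : topologicalType} (P : set X) (Q : set Y) :
  open P -> open Q -> open (P `*` Q).
Proof.
move=> oP oQ; rewrite openE => -[x y] [/= Px Qy].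
by exists (P, Q) => //; split; exact: open_nbhs_nbhs.
Qed.

Lemma dense_rectangles {X : topologicalType} (hX : ccc (X * X)%type)
    (O : set (X * X)) : open O ->
  exists A B : nat -> set X,
    [/\ forall i, open (A i) /\ open (B i), forall i, A i `*` B i `<=` O
      & O `<=` closure (\bigcup_i (A i `*` B i))].
Proof.
move=> oO.
pose T := [set PQ : set X * set X |
  [/\ open PQ.1, open PQ.2 & PQ.1 `*` PQ.2 `<=` O]].
have [||g [gT dO]] := ccc_dense_subfamily hX (T := T) (fun PQ => PQ.1 `*` PQ.2).
- by exists (set0, set0); split; [exact: open0|exact: open0|move=> ? []].
- by move=> [P Q] [oP oQ _]; exact: openX.
exists (fst \o g), (snd \o g); split=> [i|i|]; try by case: (gT i).
apply: subset_trans dO => -[x y] Oxy.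
have [[/= P Q] [Px Qy] PQO] : nbhs (x, y) O by exact: open_nbhs_nbhs.
exists (P°, Q°) => //; split; try exact: open_interior.
by apply: subset_trans PQO; apply: setSX; exact: interior_subset.
Qed.

(** The largest open set disjoint from all the [A i] with [i] in [I]. *)
Definition avoid {X : topologicalType} (A : nat -> set X) (I : set nat) : set X :=
  ~` closure (\bigcup_(i in I) A i).

Lemma open_avoid {X : topologicalType} (A : nat -> set X) (I : set nat) :
  open (avoid A I).
Proof. by apply: closed_openC; exact: closed_closure. Qed.

(** The sequence [A] does not depend on the point [p]: only the sets of indices
    [c l] do.  This is what bounds the number of points. *)
Lemma coded_slices {X : topologicalType} (hX : ccc X) (hXX : ccc (X * X)%type)
    (O N : set (X * X)) :
  open O -> open N -> O `&` N `<=` set0 ->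
  exists A : nat -> set X, forall p : X, exists c : nat -> set nat,
    [set z | N (z, p)] `<=` closure (\bigcup_l avoid A (c l)) /\
    \bigcup_l avoid A (c l) `<=` [set z | ~ O (z, p)].
Proof.
move=> oO oN ON; have [A [B [oAB ABO dO]]] := dense_rectangles hXX O oO.
exists A => p; pose T := [set I | avoid A I `<=` [set z | ~ O (z, p)]].
(* Any open rectangle with [p] in its second side that misses all the
   [A i `*` B i] has its first side inside a set [avoid A I] with [I] in [T]. *)
have key P Q : open P -> open Q -> Q p ->
    (forall i, (P `*` Q) `&` (A i `*` B i) `<=` set0) ->
    exists2 I, T I & P `<=` avoid A I.
  move=> oP oQ Qp PQ; pose I := [set i | P `&` A i `<=` set0].
  exists I; last first.
    apply: open_disjoint_closure => // x [Px [i Ii Aix]].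
    exact: (Ii x).
  move=> z Iz Ozp.
  have nb : nbhs (z, p) (avoid A I `*` Q).
    by apply: open_nbhs_nbhs; split => //; apply: openX => //; exact: open_avoid.
  have /= [[x y] [[i _ [/= Aix Biy]] [/= Ix Qy]]] := dO _ Ozp _ nb.
  have [x' [Px' Aix']] : P `&` A i !=set0.
    apply: contrapT => PAi; apply: Ix; apply: subset_closure; exists i => //.
    by move=> w Pw; apply: PAi; exists w.
  by apply: (PQ i (x', y)).
have [||c [cT dc]] := ccc_dense_subfamily hX (T := T) (avoid A).
(* [T] is nonempty: use the empty rectangle [set0 `*` setT]. *)
- have [||I TI _] := key set0 setT open0 openT; last by exists I.
  + by [].
  + by move=> i ? [[]].
- by move=> I _; exact: open_avoid.
exists c; split; last by move=> z [l _ /(cT l)].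
apply: subset_trans dc => z /= Nzp.
have [[/= P Q] [Pz Qp] PQN] : nbhs (z, p) N by exact: open_nbhs_nbhs.
have [||||I TI PI] := key P° Q°; try exact: open_interior.
- by [].
- move=> i [x y] [[/= Px Qy] AB]; apply: (ON (x, y)); split.
    exact: (ABO i).
  by apply: PQN; split; exact: interior_subset.
by exists I => //; exact: PI.
Qed.

Lemma zero_set_diagonalP {R : realType} {X : topologicalType} :
  zero_set_diagonal R X ->
  exists2 f : X * X -> R, continuous f & forall x y, f (x, y) = 0 <-> x = y.
Proof.
move=> [f [cf fdiag]]; exists f => // x y.
have -> : (f (x, y) = 0) = (f @^-1` [set 0]) (x, y) by [].
by rewrite -fdiag.
Qed.

(** The point [p] is the only one in the closures of all the sets
    [\bigcup_l avoid (A n) (code p n l)]. *)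
Lemma coded_points {R : realType} {X : topologicalType} :
  ccc X -> ccc (X * X)%type -> zero_set_diagonal R X ->
  exists code : X -> nat -> nat -> set nat, injective code.
Proof.
move=> hX hXX /zero_set_diagonalP[f cf f0].
pose e n : R := n.+1%:R^-1.
have cnf : continuous (fun z => `|f z|).
  by move=> z; apply: continuous_comp; [exact: cf|exact: norm_continuous].
have slice n : exists A : nat -> set X, forall p : X, exists c : nat -> set nat,
    [set z | `|f (z, p)| < e n] `<=` closure (\bigcup_l avoid A (c l)) /\
    \bigcup_l avoid A (c l) `<=` [set z | ~ e n < `|f (z, p)|].
  apply: (coded_slices hX hXX [set z | e n < `|f z|] [set z | `|f z| < e n]).
  - exact: (open_comp (fun z _ => cnf z) (@open_gt R (e n))).
  - exact: (open_comp (fun z _ => cnf z) (@open_lt R (e n))).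
  - by move=> z [/= h /(lt_trans h)]; rewrite ltxx.
have [A AP] := choice slice.
have [c cP] := choice (fun np : nat * X => AP np.1 np.2).
exists (fun p n => c (n, p)) => p q cpq.
apply/f0; apply: contrapT => /eqP; rewrite -normr_gt0 => /ltr_add_invr[n].
rewrite add0r => npq; have [_ sub] := cP (n, q); have [dns _] := cP (n, p).
have pcl : [set z | `|f (z, p)| < e n] p.
  by rewrite /= (f0 p p).2// normr0 invr_gt0.
have nb : nbhs p [set z | e n < `|f (z, q)|].
  apply: open_nbhs_nbhs; split => //.
  apply: (open_comp (f := fun z => `|f (z, q)|) _ (@open_gt R (e n))) => z _.
  by apply: continuous_comp (cnf _); exact: (cvg_pair cvg_id (cvg_cst q)).
have [z [zc /= nz]] := dns p pcl _ nb.
by apply: (sub z) nz; rewrite /= -(congr1 (@^~ n) cpq).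
Qed.

(** * Separability under the Continuum Hypothesis *)

Section ternary.
Context {R : realType}.

(** Partial sums of the series of the [b i / 3 ^ i], for a bit sequence [b]. *)
Definition ternary_sum (b : nat -> bool) (n : nat) : R :=
  \sum_(i < n) (b i)%:R * 3^-1 ^+ i.

(** The sum of the series of the [b i / 3 ^ i], as the supremum of its partial
    sums.  It embeds the bit sequences into the reals. *)
Definition ternary (b : nat -> bool) : R := sup (range (ternary_sum b)).

Lemma ternary_sumS b n :
  ternary_sum b n.+1 = ternary_sum b n + (b n)%:R * 3^-1 ^+ n.
Proof. by rewrite /ternary_sum big_ord_recr. Qed.

Lemma ternary_sum_homo b : {homo ternary_sum b : m n / (m <= n)%N >-> m <= n}.
Proof.
apply: (@homo_leq R _ <=%R) => [//|y x z|n]; first exact: le_trans.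
by rewrite ternary_sumS lerDl mulr_ge0// exprn_ge0// invr_ge0.
Qed.

(** Adding to each partial sum the largest possible remainder,
    [3 ^ -n + 3 ^ -(n + 1) + ... = 3 / 2 * 3 ^ -n], gives a nonincreasing
    sequence. *)
Lemma ternary_sum_tail b m n : (m <= n)%N ->
  ternary_sum b n + 3 / 2 * 3^-1 ^+ n <= ternary_sum b m + 3 / 2 * 3^-1 ^+ m.
Proof.
elim: n => [|n IH]; first by rewrite leqn0 => /eqP->.
rewrite leq_eqVlt => /predU1P[->//|/IH]; apply: le_trans.
rewrite ternary_sumS exprS.
have : 0 <= (3^-1 : R) ^+ n by rewrite exprn_ge0// invr_ge0.
by case: (b n) => /=; lra.
Qed.

Lemma ternary_bounds b n :
  ternary_sum b n <= ternary b <= ternary_sum b n + 3 / 2 * 3^-1 ^+ n.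
Proof.
have ub : ubound (range (ternary_sum b)) (ternary_sum b n + 3 / 2 * 3^-1 ^+ n).
  move=> _ [m _ <-]; have pos k : 0 <= 3 / 2 * (3^-1 : R) ^+ k.
    by rewrite mulr_ge0// ?exprn_ge0// ?invr_ge0// divr_ge0.
  have [mn|/ltnW nm] := leqP m n.
    by rewrite (le_trans (ternary_sum_homo b _ _ mn))// lerDl.
  by apply: le_trans (ternary_sum_tail b _ _ nm); rewrite lerDl.
apply/andP; split.
- apply: ub_le_sup; last by exists n.
  by exists (ternary_sum b n + 3 / 2 * 3^-1 ^+ n).
- by apply: ge_sup => //; exists (ternary_sum b 0%N); exists 0%N.
Qed.

Lemma ternary_inj : injective (ternary : (nat -> bool) -> R).
Proof.
(* At the first place [k] where [b] and [c] differ, the bit of [b] contributes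
   [3 ^ -k], while all later bits of [c] contribute at most half of that. *)
suff lt_ternary (b c : nat -> bool) k : (forall i, (i < k)%N -> b i = c i) ->
    b k -> ~~ c k -> ternary c < ternary b :> R.
  move=> b c bc; apply: contrapT => bNc.
  have ex : exists k, b k != c k.
    apply: contrapT => /forallNP h; apply: bNc; apply: funext => k.
    by apply/eqP/negPn/negP; exact: h.
  case: (ex_minnP ex) => k kP kmin.
  have below i : (i < k)%N -> b i = c i.
    by move=> ik; apply/eqP/negPn/negP => /kmin; rewrite leqNgt ik.
  case bk : (b k); case ck : (c k); rewrite ?bk ?ck// in kP.
  - by have := lt_ternary b c k below bk (negbT ck); rewrite bc ltxx.
  - have := lt_ternary c b k (fun i ik => esym (below i ik)) ck (negbT bk).
    by rewrite bc ltxx.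
move=> below bk ck.
have /andP[lb _] := ternary_bounds b k.+1.
have /andP[_ ub] := ternary_bounds c k.+1.
have same : ternary_sum b k = ternary_sum c k.
  by apply: eq_bigr => i _; rewrite below.
move: lb ub; rewrite !ternary_sumS same bk (negbTE ck) exprS.
have : 0 < (3^-1 : R) ^+ k by rewrite exprn_gt0// invr_gt0.
by rewrite /=; lra.
Qed.

End ternary.

Lemma countable_preimage {S T : Type} {h : S -> T} {B : set T} :
  injective h -> countable B -> countable (h @^-1` B).
Proof.
move=> hinj /countable_injP[g ginj]; apply/countable_injP; exists (g \o h).
by move=> x y; rewrite !inE => Bx By /= ghxy; apply/hinj/ginj; rewrite ?inE.
Qed.

(** Sierpinski's consequence of CH, from a well-order [r] of the reals: if some
    initial segment of [r] is uncountable, the first such one has the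
    cardinality of the continuum, and the order is pulled back along an
    injection of the reals into it. *)
Lemma real_countable_segments {R : realType} : continuum_hypothesis R ->
  exists le : R -> R -> Prop, (forall x y, le x y \/ le y x) /\
    forall y, countable [set x | le x y].
Proof.
move=> CH; have [r rwo] := wochoice.well_ordering_principle R.
have wor : wochoice.wo_chain r predT by move=> A _; exact: rwo.
have rtot x y : r x y || r y x by exact: (wochoice.wo_chainW wor).
have [allc|] := pselect (forall t, countable [set s | r s t]).
  exists r; split => // x y; exact/orP.
move=> /existsNP[t1 t1unc].
pose S := [pred t | `[< ~ countable [set s | r s t] >]].
have [|t0 [[/asboolP t0unc t0min] _]] := rwo S.
  by exists t1; apply/asboolP.
(* The strict segment below [t0]: all segments of its elements are countable. *)
pose A := [set s | r s t0 && (s != t0)].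
have Aunc : ~ countable A.
  move=> cA; apply: t0unc.
  suff -> : [set s | r s t0] = A `|` [set t0].
    by rewrite -bigcup2E; apply: bigcup_countable => // -[|[|i]] _ /=.
  apply/seteqP; split => [s /= st0|s [/andP[]//|->] /=].
    have [->|ne] := eqVneq s t0; [by right|by left; apply/andP].
  by have := rtot t0 t0; rewrite orbb.
have [//|] := CH A; rewrite card_eq_le => /andP[_].
move=> /ppcard_leP[phi].
have phiA x : A (phi x) by apply: funS.
have phi_inj : injective phi by move=> x y; apply: inj; rewrite inE.
exists (fun x y => r (phi x) (phi y)); split => [x y|y]; first exact/orP.
apply: (countable_preimage (B := [set s | r s (phi y)]) phi_inj).
apply: contrapT => yunc; have /andP[yt0 /eqP] := phiA y; apply.
apply: (wochoice.wo_chain_antisymmetric wor) => //; rewrite yt0/=.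
by apply: t0min; apply/asboolP.
Qed.

Lemma countable_segments {R : realType} {X : Type}
    (code : X -> nat -> nat -> set nat) :
  continuum_hypothesis R -> injective code ->
  exists le : X -> X -> Prop, (forall x y, le x y \/ le y x) /\
    forall y, countable [set x | le x y].
Proof.
move=> CH codeI; have [le [letot lec]] := real_countable_segments CH.
pose bits x k : bool :=
  if unpickle k is Some (n, l, i) then `[< code x n l i >] else false.
pose h x : R := ternary (bits x).
have hI : injective h.
  move=> x y /ternary_inj bxy; apply: codeI.
  apply/funext => n; apply/funext => l; apply/funext => i.
  have := congr1 (@^~ (pickle (n, l, i))) bxy; rewrite /bits/= pickleK.
  by move=> ixy; apply/propext; exact: (asbool_eq_equiv ixy).
exists (fun x y => le (h x) (h y)); split => [x y|y]; first exact: letot.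
exact: (countable_preimage (B := [set s | le s (h y)]) hI).
Qed.

Lemma caliber_separable {X : topologicalType} {le : X -> X -> Prop} :
  caliber_omega1 X -> (forall x y, le x y \/ le y x) ->
  (forall y, countable [set x | le x y]) ->
  exists2 D : set X, countable D & closure D = setT.
Proof.
move=> hcal letot lec; apply: contrapT => nsep.
have Xunc : ~ countable [set: X].
  by move=> cX; apply: nsep; exists setT => //; exact: closureT.
pose U y := ~` closure [set x | le x y].
have [y _|T [_ Tunc [a aT]]] := caliber_indexed hcal (A := U) Xunc.
  split; first by apply: closed_openC; exact: closed_closure.
  apply/set0P/negP => /eqP Uy0; apply: nsep; exists [set x | le x y] => //.
  by rewrite -[LHS]setCK -/(U y) Uy0 setC0.
apply: Tunc; apply: sub_countable (lec a); apply: subset_card_le => t Tt.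
have [lat|//] := letot a t.
by have := aT t Tt; case; exact: subset_closure.
Qed.

(** * Metrization by a separating sequence of functions *)

(** The axioms of a metric; nonnegativity follows from the other axioms. *)
Record is_distance {R : realType} {T : Type} (d : T -> T -> R) : Prop := {
  distxx : forall x, d x x = 0 ;
  dist_positivity : forall x y, d x y = 0 -> x = y ;
  dist_sym : forall x y, d x y = d y x ;
  dist_triangle : forall y x z, d x z <= d x y + d y z
}.

(** A copy of [T] that carries the metric structure of the distance [d]. *)
Definition metrized {R : realType} {T : choiceType} {d : T -> T -> R}
  (dP : is_distance d) : Type := T.

Section metrized.
Context {R : realType} {T : choiceType} {d : T -> T -> R} (dP : is_distance d).

HB.instance Definition _ := Choice.on (metrized dP).
HB.instance Definition _ := isMetric.Build R (metrized dP)
  (distxx _ dP) (dist_positivity _ dP) (dist_sym _ dP) (dist_triangle _ dP).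

End metrized.

Lemma submetrizable_distance {R : realType} {X : topologicalType}
    {d : X -> X -> R} (dP : is_distance d) :
  (forall x e, 0 < e -> nbhs x [set y | d x y < e]) -> submetrizable R X.
Proof.
move=> nd; exists (Topological.class (metrized dP)); split; last first.
  by exists (Metric.class (metrized dP)).
move=> A; rewrite !openE => oA x /oA; rewrite /interior.
move=> /(@nbhs_ballP _ (metrized dP)) [e /= e0 eA].
by apply: filterS (nd x e e0); exact: eA.
Qed.

Section separating_sequence.
Context {R : realType} {X : Type} (g : nat -> X -> R).

(** The [k]-th contribution to the distance between [x] and [y], truncated at
    [1 / k.+1] so that only finitely many [k] matter at any given scale. *)
Definition seq_gap (x y : X) (k : nat) : R :=
  Num.min `|g k x - g k y| k.+1%:R^-1.

(** The distance defined by the sequence [g], a supremum of truncated gaps. *)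
Definition seq_dist (x y : X) : R := sup (range (seq_gap x y)).

Lemma seq_gap_ge0 x y k : 0 <= seq_gap x y k.
Proof. by rewrite le_min normr_ge0 invr_ge0 ler0n. Qed.

Lemma seq_gap_le_dist x y k : seq_gap x y k <= seq_dist x y.
Proof.
apply: ub_le_sup; last by exists k.
exists 1 => _ [j _ <-]; rewrite ge_min; apply/orP; right.
by rewrite invf_le1 ?ler1n ?ltr0n.
Qed.

Lemma seq_dist_le x y e : (forall k, seq_gap x y k <= e) -> seq_dist x y <= e.
Proof.
move=> le_e; apply: ge_sup => [|_ [k _ <-]]; last exact: le_e.
by exists (seq_gap x y 0%N), 0%N.
Qed.

Lemma is_distance_seq_dist :
  (forall x y, (forall k, g k x = g k y) -> x = y) -> is_distance seq_dist.
Proof.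
move=> gsep; split.
- move=> x; apply/eqP; rewrite eq_le; apply/andP; split.
    by apply: seq_dist_le => k; rewrite /seq_gap subrr normr0 ge_min lexx.
  exact: le_trans (seq_gap_ge0 x x 0) (seq_gap_le_dist _ _ _).
- move=> x y dxy; apply: gsep => k; apply/eqP; rewrite -subr_eq0 -normr_le0.
  have := seq_gap_le_dist x y k; rewrite dxy ge_min => /orP[//|].
  by rewrite invr_le0 lern0.
- move=> x y; rewrite /seq_dist; suff -> : seq_gap x y = seq_gap y x by [].
  apply/funext => k.
  by rewrite /seq_gap distrC.
- move=> y x z; apply: seq_dist_le => k.
  apply: le_trans _ (lerD (seq_gap_le_dist x y k) (seq_gap_le_dist y z k)).
  rewrite /seq_gap; set e := k.+1%:R^-1; have e0 : 0 <= e by rewrite invr_ge0 ler0n.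
  have := ler_distD (g k y) (g k x) (g k z).
  have := normr_ge0 (g k x - g k y); have := normr_ge0 (g k y - g k z).
  by rewrite !minEle; do 3 case: ifPn; rewrite -?ltNge; lra.
Qed.

End separating_sequence.

Lemma submetrizable_separating_sequence {R : realType} {X : topologicalType}
    (g : nat -> X -> R) :
  (forall k, continuous (g k)) ->
  (forall x y, (forall k, g k x = g k y) -> x = y) -> submetrizable R X.
Proof.
move=> gc gsep; apply: (submetrizable_distance (is_distance_seq_dist g gsep)).
move=> x e e0; have [N] := ltr_add_invr e0; rewrite add0r => Ne.
have : nbhs x [set y | forall k : 'I_N, `|g k x - g k y| < N.+1%:R^-1].
  apply: filter_forall => k.
  by apply: (@cvgr_dist_lt _ _ _ _ _ _ (g k x) (gc k x)); rewrite invr_gt0.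
apply: filterS => y near_y /=; apply: le_lt_trans Ne; apply: seq_dist_le => k.
rewrite ge_min; have [kN|Nk] := ltnP k N.
  by rewrite (ltW (near_y (Ordinal kN))).
by rewrite lef_pV2 ?posrE// ler_nat ltnS Nk orbT.
Qed.

(** In a separable space with a zero-set diagonal, the functions [f (_, z)] with
    [z] in the dense set separate points. *)
Lemma submetrizable_separable {R : realType} {X : topologicalType} {D : set X} :
  zero_set_diagonal R X -> countable D -> closure D = setT -> submetrizable R X.
Proof.
move=> /zero_set_diagonalP[f cf f0] /countable_injP[h hinj] Ddense.
have cfl z : continuous (fun x => f (x, z)).
  by move=> x; apply: continuous_comp (cf _); exact: (cvg_pair cvg_id (cvg_cst z)).
have cfr x : continuous (fun z => f (x, z)).
  by move=> z; apply: continuous_comp (cf _); exact: (cvg_pair (cvg_cst x) cvg_id).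
(* The functions [f (_, z)] are enumerated along the injection [h] of [D] into
   the naturals, with the zero function at the unused indices. *)
have gP k : exists phi : X -> R, continuous phi /\
    forall z, D z -> h z = k -> phi = fun x => f (x, z).
  have [[z [Dz hz]]|none] := pselect (exists z, D z /\ h z = k).
    exists (fun x => f (x, z)); split => // z' Dz' hz'.
    by rewrite (hinj z z') ?inE// hz hz'.
  exists (fun=> 0); split; first exact: cst_continuous.
  by move=> z Dz hz; case: none; exists z.
have [g gD] := choice gP.
apply: (submetrizable_separating_sequence g) => [k|x y gxy].
  by have [] := gD k.
have Deq z : D z -> f (x, z) - f (y, z) = 0.
  move=> Dz; have [_ /(_ z Dz erefl) ghz] := gD (h z).
  by have := gxy (h z); rewrite ghz => ->; rewrite subrr.
apply/esym/f0.
apply: contrapT => /eqP ne0.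
have nb : nbhs x [set z | f (x, z) - f (y, z) != 0].
  apply: open_nbhs_nbhs; split; last by rewrite /= (f0 x x).2// sub0r oppr_eq0.
  apply: (open_comp (f := fun z => f (x, z) - f (y, z)) _ (@open_neq R 0)) => z _.
  exact: (cvgB (cfr x z) (cfr y z)).
have : closure D x by rewrite Ddense.
by move=> /(_ _ nb)[z [Dz /=]]; rewrite Deq// eqxx.
Qed.

Theorem corollary3p2 (R : realType) (CH : continuum_hypothesis R)
    (X : topologicalType) (hT1 : accessible_space X)
    (hdiag : zero_set_diagonal R X) (hcal : caliber_omega1 X) :
  submetrizable R X.
Proof.
have [code codeI] :=
  coded_points (caliber_ccc X hcal) (caliber_ccc_prod X hcal) hdiag.
have [le [letot lec]] := countable_segments code CH codeI.
have [D cD dD] := caliber_separable hcal letot lec.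
exact: submetrizable_separable hdiag cD dD.
Qed.
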